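(* Let $X,Z\in\mathcal{L}_1$. If $Z$ is left skewed and the copula $C$ of $(X,Z)$ satisfies $$C(u,v)+C(u,1-v)\geq u\quad\text{for all }u,v\in[0,1],$$ then $X\geq_{ICV}X+Z$.
   Context: $\mathcal{L}_1$ is the set of integrable real random variables on an atomless probability space $(\Omega,\mathcal{F},\Pr)$. A copula of $(X,Z)$ is a bivariate copula $C$ such that $\Pr(X\leq x,Z\leq z)=C(F(x),G(z))$ for all $x,z\in\mathbb{R}$, where $F(x)=\Pr(X\leq x)$ and $G(z)=\Pr(Z\leq z)$ (it is unique if $F$ and $G$ are continuous). A random variable $Z$ with cumulative distribution function $G$ is left skewed if $G(-z)\geq 1-G(z)$ for all $z\geq 0$ such that $G(z-)=G(z)$, where $G(z-)$ is the left limit of $G$ at $z$. For $X,Y\in\mathcal{L}_1$, $X\leq_{ICV}Y$ (increasing concave order) means $E(u(X))\leq E(u(Y))$ for all increasing (i.e. non-decreasing) concave functions $u:\mathbb{R}\to\mathbb{R}$ such that these expectations exist; equivalently, $\int_{-\infty}^t \Pr(X\leq x)\,dx\geq\int_{-\infty}^t \Pr(Y\leq x)\,dx$ for all $t\in\mathbb{R}$. $X\geq_{ICV}Y$ means $Y\leq_{ICV}X$. *)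

(* Defs.v *)
From HB Require Import structures.
From mathcomp Require Import all_boot all_order all_algebra.
From mathcomp Require Import all_classical all_reals all_analysis.

Set Implicit Arguments.
Unset Strict Implicit.
Unset Printing Implicit Defensive.

Import Order.TTheory GRing.Theory Num.Theory.
Import numFieldNormedType.Exports.

Local Open Scope classical_set_scope.
Local Open Scope ring_scope.

Definition atomless (d : measure_display) (T : measurableType d) (R : realType)
    (P : probability T R) : Prop :=
  forall A : set T, measurable A -> (0 < P A)%E ->
    exists B : set T, [/\ measurable B, B `<=` A, (0 < P B)%E & (P B < P A)%E].

(* A copula is a function on [0, 1]^2; it is encoded by a total function on
   R^2 whose values off the unit square are irrelevant. That its values on the
   square lie in [0, 1] follows from the three conditions. *)
Record is_copula (R : realType) (C : R -> R -> R) : Prop := IsCopula {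
  copula_grounded : forall u, 0 <= u <= 1 -> C u 0 = 0 /\ C 0 u = 0 ;
  copula_margins : forall u, 0 <= u <= 1 -> C u 1 = u /\ C 1 u = u ;
  copula_2increasing : forall u1 u2 v1 v2,
    0 <= u1 -> u1 <= u2 -> u2 <= 1 -> 0 <= v1 -> v1 <= v2 -> v2 <= 1 ->
    0 <= C u2 v2 - C u2 v1 - C u1 v2 + C u1 v1
}.

Section RandomVariables.
Context (d : measure_display) (T : measurableType d) (R : realType).
Variable P : probability T R.
Implicit Types X Z : {RV P >-> R}.

(* Real-valued version of [cdf], which takes its values in \bar R. *)
Definition rcdf X (x : R) : R := fine (cdf X x).

Definition copula_of (C : R -> R -> R) X Z : Prop :=
  is_copula C /\
  forall x z : R,
    P [set w | X w <= x /\ Z w <= z] = (C (rcdf X x) (rcdf Z z))%:E.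

Definition left_skewed Z : Prop :=
  forall z : R, 0 <= z ->
    rcdf Z y @[y --> z^'-] --> rcdf Z z ->
    1 - rcdf Z z <= rcdf Z (- z).

(* The expectation exists, possibly with an infinite value: it is not of the
   form +oo - +oo. *)
Definition expectation_exists (f : T -> R) : Prop :=
  ('E_P[f^\+] < +oo)%E \/ ('E_P[f^\-] < +oo)%E.

Definition concave_function (u : R -> R) : Prop :=
  convex_function [set: convex_lmodType R^o] (fun x => - u x).

Definition leICV (X Y : T -> R) : Prop :=
  forall u : R -> R, nondecreasing_fun u -> concave_function u ->
    expectation_exists (u \o X) -> expectation_exists (u \o Y) ->
    ('E_P[u \o X] <= 'E_P[u \o Y])%E.

End RandomVariables.

(* Main.v *)
Require Import Defs.
From HB Require Import structures.
From mathcomp Require Import all_boot all_order all_algebra.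
From mathcomp Require Import all_classical all_reals all_analysis.
From mathcomp Require Import measurable_realfun ring lra.

Set Implicit Arguments.
Unset Strict Implicit.
Unset Printing Implicit Defensive.

Import Order.TTheory GRing.Theory Num.Theory.
Import numFieldNormedType.Exports.

Local Open Scope classical_set_scope.
Local Open Scope ring_scope.

(** Write F and G for the distribution functions of X and Z. At a continuity
    point z >= 0 of G, left skewness gives G(-z) >= 1 - G(z), and since C is
    nondecreasing in its second argument the copula condition turns into
        P(X <= x, Z <= -z) >= C(F(x), 1 - G(z)) >= F(x) - C(F(x), G(z))
                            = P(X <= x, Z > z)
    ([copula_tail_le]). So on every event X <= x the lower tail of Z outweighs
    its upper tail, and the tail formula for the mean gives
    E(Z ; X <= x) <= 0 ([expectation_indic_le0]). The same holds for every
    event on which X belongs to a lower set of reals, and the superlevel sets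
    of a nonincreasing function are lower sets; hence E(Z k(X)) <= 0 for all
    bounded nonnegative nonincreasing k
    ([expectation_mul_nonincreasing_le0]).

    Now let u be nondecreasing and concave, with supergradient g, which is
    nonnegative and nonincreasing. If g were bounded, integrating the tangent
    inequality u(X + Z) <= u(X) + g(X) Z would finish the proof. In general g
    may blow up at -oo, so the tangent is taken at max(X, -n) instead:
    u(X + Z) <= u_n(X) + g(max(X, -n)) Z, where u_n is u with its graph below
    -n replaced by the tangent at -n ([tangent_extension]). Then
    E u(X + Z) <= E u_n(X), and u_n decreases to u, so that monotone
    convergence concludes, whether or not E u(X) is finite
    ([expectation_nonincreasing_limit_ge]). *)

(** * Supergradients of nondecreasing concave functions *)

Section ConcaveSlope.
Local Open Scope convex_scope.
Context (R : realType) (u : R -> R).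
Hypotheses (und : nondecreasing_fun u) (uconc : concave_function u).

Lemma concave_chord (x y z : R) : x < y -> y < z ->
  (u z - u y) * (y - x) <= (u y - u x) * (z - y).
Proof.
move=> xy yz.
have zx : 0 < z - x by rewrite subr_gt0 (lt_trans xy).
have t0 : 0 <= (z - y) / (z - x) by rewrite divr_ge0 ?ltW// subr_gt0.
have t1 : (z - y) / (z - x) <= 1.
  by rewrite ler_pdivrMr// mul1r lerD2l lerN2 ltW.
have := @uconc (Itv01 t0 t1) x z (in_setT _) (in_setT _).
rewrite [X in _ <= X -> _](_ : _ =
  (z - y) / (z - x) * - u x + (1 - (z - y) / (z - x)) * - u z)//.
have -> : ((x : convex_lmodType R^o) <| Itv01 t0 t1 |>
           (z : convex_lmodType R^o)) = y.
  rewrite [LHS](_ : _ = (z - y) / (z - x) * x + (1 - (z - y) / (z - x)) * z)//.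
  by field; rewrite gt_eqF.
rewrite -(ler_pM2l zx) => h.
have {h} : (z - x) * - u y <= (z - y) * - u x + (y - x) * - u z.
  apply: (le_trans h); rewrite le_eqVlt; apply/orP; left; apply/eqP.
  by field; rewrite gt_eqF.
lra.
Qed.

(** The infimum of these slopes is the left derivative of u; the chords to the
    right of x are less steep than all of them, so it is a supergradient. *)
Definition left_slopes (x : R) : set R :=
  [set (u x - u y) / (x - y) | y in [set y | y < x]].

Definition left_slope (x : R) : R := inf (left_slopes x).

Lemma left_slopes_neq0 x : left_slopes x !=set0.
Proof. by exists ((u x - u (x - 1)) / (x - (x - 1))), (x - 1) => //=; lra. Qed.

Lemma left_slopes_ge0 x : lbound (left_slopes x) 0.
Proof.
move=> _ [y /= yx <-]; apply: divr_ge0; rewrite subr_ge0 ?(ltW yx)//.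
by apply: und; exact: ltW.
Qed.

Lemma left_slope_ge0 x : 0 <= left_slope x.
Proof. exact: (lb_le_inf (left_slopes_neq0 x) (@left_slopes_ge0 x)). Qed.

Lemma left_slope_le_chord x y : y < x -> left_slope x <= (u x - u y) / (x - y).
Proof.
move=> yx; apply: ge_inf; last by exists y.
by exists 0; exact: left_slopes_ge0.
Qed.

Lemma chord_le_left_slope x y : x < y -> (u y - u x) / (y - x) <= left_slope x.
Proof.
move=> xy; apply: (lb_le_inf (left_slopes_neq0 x)) => _ [z /= zx <-].
rewrite ler_pdivlMr ?subr_gt0// mulrAC ler_pdivrMr ?subr_gt0//.
exact: concave_chord.
Qed.

Lemma left_slope_nonincreasing : nonincreasing_fun left_slope.
Proof.
move=> x y; rewrite le_eqVlt => /predU1P[->//|xy].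
exact: (le_trans (left_slope_le_chord xy) (chord_le_left_slope xy)).
Qed.

Lemma concave_le_tangent x y : u y <= u x + left_slope x * (y - x).
Proof.
have [yx|xy|->] := ltgtP y x; last by rewrite subrr mulr0 addr0.
- have := left_slope_le_chord yx; rewrite ler_pdivlMr ?subr_gt0//; lra.
- have := chord_le_left_slope xy; rewrite ler_pdivrMr ?subr_gt0//; lra.
Qed.

(** For x >= m this is u x, and for x < m it is the tangent to u at m: a
    Lipschitz concave function above u. The formula is the tangent at
    max(x, m) evaluated at x, so that both cases are instances of
    [concave_le_tangent]. *)
Definition tangent_extension (m x : R) : R :=
  u (Num.max x m) + left_slope (Num.max x m) * (x - Num.max x m).

Lemma concave_le_tangent_extension m x y :
  u y <= tangent_extension m x + left_slope (Num.max x m) * (y - x).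
Proof.
have := concave_le_tangent (Num.max x m) y; rewrite /tangent_extension; lra.
Qed.

Lemma tangent_extension_id m x : m <= x -> tangent_extension m x = u x.
Proof. by move=> mx; rewrite /tangent_extension max_l// subrr mulr0 addr0. Qed.

(** The tangents at a <= b satisfy t_a <= t_b to the left of a: t_b is above
    the graph at the point a, and it is the less steep of the two. *)
Lemma tangent_extension_homo m m' x : m <= m' ->
  tangent_extension m x <= tangent_extension m' x.
Proof.
move=> mm'; rewrite /tangent_extension.
set a := Num.max x m; set b := Num.max x m'.
have ab : a <= b by rewrite /a /b ge_max !le_max lexx mm' orbT.
have xa : x <= a by rewrite /a le_max lexx.
have := concave_le_tangent b a.
have := ler_wnM2r (_ : x - a <= 0) (left_slope_nonincreasing ab).
by rewrite subr_le0 => /(_ xa); lra.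
Qed.

Lemma tangent_extension_le m x : m <= 0 ->
  tangent_extension m x <= u 0 + left_slope 0 * x.
Proof.
move=> m0; apply: (le_trans (tangent_extension_homo x m0)).
rewrite /tangent_extension; have [x0|x0] := leP x 0; first by rewrite subr0.
by have := concave_le_tangent 0 x; rewrite subrr mulr0 addr0 subr0.
Qed.

Lemma tangent_extension_ge m x :
  u m - left_slope m * `|x - m| <= tangent_extension m x.
Proof.
rewrite /tangent_extension; have [xm|mx] := leP x m.
  by rewrite ler0_norm ?subr_le0//; lra.
have := und (ltW mx); have := left_slope_ge0 m.
have := normr_ge0 (x - m); nra.
Qed.

End ConcaveSlope.

(** * Tails of a copula with a left skewed margin *)

Lemma itvNyoEbigcup (R : realType) (x : R) :
  `]-oo, x[%classic = \bigcup_n `]-oo, x - n.+1%:R^-1]%classic.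
Proof.
apply/seteqP; split => y /=; rewrite in_itv/=.
  move=> /ltr_add_invr[k yx]; exists k => //=.
  by rewrite in_itv/= lerBrDr ltW.
move=> [n _] /=; rewrite in_itv/= => /le_lt_trans; apply.
by rewrite ltrBlDr ltrDl invr_gt0.
Qed.

(** A lower set is a ray, possibly open or the whole line; exhausting it by
    closed rays covers all these cases at once. *)
Lemma lower_set_bigcup (R : realType) (D : set R) : D !=set0 ->
  (forall x y, D x -> y <= x -> D y) ->
  exists2 a : R^nat, nondecreasing_seq a & D = \bigcup_n `]-oo, a n]%classic.
Proof.
move=> D0 Dlow; have [ubD|nubD] := pselect (has_ubound D); last first.
  exists (fun n => n%:R); first by move=> n m nm; rewrite ler_nat.
  apply/seteqP; split => x.
    move=> _; exists (Num.truncn x).+1 => //=.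
    by rewrite in_itv/= ltW// truncnS_gt.
  move=> [n _]; rewrite /= in_itv/= => xn.
  apply: contrapT => Dx; apply: nubD; exists x => y Dy.
  by rewrite leNgt; apply/negP => /ltW /(Dlow _ _ Dy).
have [Ds|nDs] := pselect (D (sup D)).
  exists (fun=> sup D) => //; apply/seteqP; split => x.
    by move=> Dx; exists 0%N => //=; rewrite in_itv/=; exact: ub_le_sup.
  by move=> [n _] /=; rewrite in_itv/=; exact: Dlow.
exists (fun n => sup D - n.+1%:R^-1).
  by move=> n m nm; rewrite lerD2l lerN2 lef_pV2 ?posrE// ler_nat.
rewrite -itvNyoEbigcup; apply/seteqP; split => x /=; rewrite in_itv/=.
  move=> Dx; rewrite lt_neqAle ub_le_sup// andbT.
  by apply: contra_notN nDs => /eqP <-.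
move=> /sup_gt [|y Dy /ltW]; [exact: D0|exact: Dlow].
Qed.

Section Tails.
Context (d : measure_display) (T : measurableType d) (R : realType).
Variable P : probability T R.
Implicit Types X Z : {RV P >-> R}.

Lemma rcdfK X x : (rcdf X x)%:E = P (X @^-1` `]-oo, x]).
Proof. by rewrite /rcdf fineK// fin_num_measure. Qed.

Lemma rcdf_nondecreasing X : nondecreasing_fun (rcdf X).
Proof. by move=> x y xy; rewrite -lee_fin !rcdfK; exact: cdf_nondecreasing. Qed.

Lemma rcdf_itv X x : 0 <= rcdf X x <= 1.
Proof.
by rewrite -!lee_fin rcdfK measure_ge0 probability_le1//; exact: measurable_funPTI.
Qed.

(** The jump of the distribution function at x is the mass of X at x. *)
Lemma rcdf_left_continuous X x : pmf X x = 0 ->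
  rcdf X y @[y --> x^'-] --> rcdf X x.
Proof.
move=> atom0; apply/cvgrPdist_lt => e e0.
pose F n := X @^-1` `]-oo, x - n.+1%:R^-1].
have FE : P (\bigcup_n F n) = (rcdf X x)%:E.
  have -> : \bigcup_n F n = X @^-1` `]-oo, x[.
    by rewrite /F -preimage_bigcup -itvNyoEbigcup.
  rewrite rcdfK -(@setUitv1 _ _ _ x true)// preimage_setU measureU//.
  - rewrite [X in (_ + X)%E](_ : _ = 0%E) ?adde0//.
    by rewrite -[LHS]fineK ?fin_num_measure// -/(pmf X x) atom0.
  - exact: measurable_funPTI.
  - by rewrite -preimage_setI -subset0 => t /= [] /[swap] ->; rewrite in_itv/= ltxx.
have : (P \o F) n @[n --> \oo] --> (rcdf X x)%:E.
  rewrite -FE; apply: nondecreasing_cvg_mu.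
  - by move=> n; exact: measurable_funPTI.
  - by apply: bigcup_measurable => n _; exact: measurable_funPTI.
  - move=> n m nm; apply/subsetPset; apply: preimage_subset.
    by apply: subset_itvl; rewrite bnd_simp lerD2l lerN2 lef_pV2 ?posrE// ler_nat.
have -> : P \o F = (fun n => (rcdf X (x - n.+1%:R^-1))%:E).
  by apply/funext => n; rewrite rcdfK.
move/fine_cvgP => [_] /cvgrPdist_lt /(_ e e0) [N _ /(_ N (leqnn N))] /= dN.
have xN : x - N.+1%:R^-1 < x by rewrite ltrBlDr ltrDl invr_gt0.
near=> y.
have yx : y < x by near: y; exact: nbhs_left_lt.
have Ny : x - N.+1%:R^-1 <= y by near: y; exact: nbhs_left_ge.
have := rcdf_nondecreasing X (ltW yx).
have := rcdf_nondecreasing X Ny.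
move: dN; rewrite !ltr_norml; lra.
Unshelve. all: end_near. Qed.

(** P(X <= x, Z > z) = F(x) - C(F(x), G(z)) <= C(F(x), 1 - G(z))
    <= C(F(x), G(-z)), by the hypothesis on C and the monotonicity of
    C(F(x), .). *)
Lemma copula_tail_le X Z (C : R -> R -> R) (x z : R) :
  left_skewed Z -> copula_of C X Z ->
  (forall u v : R, 0 <= u <= 1 -> 0 <= v <= 1 -> u <= C u v + C u (1 - v)) ->
  0 <= z -> pmf Z z = 0 ->
  (P (X @^-1` `]-oo, x] `&` Z @^-1` `]z, +oo[) <=
   P (X @^-1` `]-oo, x] `&` Z @^-1` `]-oo, (- z)%R]))%E.
Proof.
move=> skew [[Cgr Cmar C2] Cdist] Cge z0 atom0.
have Fle := rcdf_itv X x.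
have Gz := rcdf_itv Z z; have GNz := rcdf_itv Z (- z).
have sk := skew z z0 (rcdf_left_continuous atom0).
have mS W a : measurable ((W : {RV P >-> R}) @^-1` `]-oo, a]).
  exact: measurable_funPTI.
have CE a :
    P (X @^-1` `]-oo, x] `&` Z @^-1` `]-oo, a]) =
    (C (rcdf X x) (rcdf Z a))%:E.
  rewrite -Cdist; congr (P _); apply/seteqP; split => t /=; by rewrite !in_itv/=.
(* C(u, .) is nondecreasing: 2-increasingness on the rectangle
   [0, F(x)] x [1 - G(z), G(-z)], the copula being 0 on its left side. *)
have Cmono : C (rcdf X x) (1 - rcdf Z z) <= C (rcdf X x) (rcdf Z (- z)).
  have /andP[F0 F1] := Fle; have /andP[G0 G1] := GNz.
  have Gc : 0 <= 1 - rcdf Z z <= 1 by case/andP: Gz => *; apply/andP; split; lra.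
  have Gc0 : 0 <= 1 - rcdf Z z by case/andP: Gc.
  have := C2 0 (rcdf X x) _ _ (lexx 0) F0 F1 Gc0 sk G1.
  rewrite (Cgr _ Gc).2 (Cgr _ GNz).2; lra.
have -> : P (X @^-1` `]-oo, x] `&` Z @^-1` `]z, +oo[) =
          (rcdf X x - C (rcdf X x) (rcdf Z z))%:E.
  have -> : Z @^-1` `]z, +oo[ = ~` (Z @^-1` `]-oo, z]).
    by rewrite preimage_setC setCitvl.
  rewrite -setDE measureD//; last by rewrite ltey_eq fin_num_measure.
  by rewrite EFinB rcdfK -CE.
by have := Cge _ _ Fle Gz; rewrite CE lee_fin; lra.
Qed.

Lemma lower_set_tail_le X (B B' : set T) (D : set R) :
  measurable B -> measurable B' ->
  (forall x y, D x -> y <= x -> D y) ->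
  (forall x, P (X @^-1` `]-oo, x] `&` B) <= P (X @^-1` `]-oo, x] `&` B'))%E ->
  (P (X @^-1` D `&` B) <= P (X @^-1` D `&` B'))%E.
Proof.
move=> mB mB' Dlow BB'; have [->|/set0P D0] := eqVneq D set0.
  by rewrite preimage_set0 !set0I.
have [a nda ->] := lower_set_bigcup D0 Dlow.
(* Continuity from below of P(. `&` E) along the exhaustion of D. *)
have cvgP E : measurable E ->
    P (X @^-1` `]-oo, a n] `&` E) @[n --> \oo] -->
    P (X @^-1` (\bigcup_n `]-oo, a n]%classic) `&` E).
  move=> mE; rewrite preimage_bigcup setI_bigcupl.
  apply: (@nondecreasing_cvg_mu _ _ _ P (fun n => X @^-1` `]-oo, a n] `&` E)).
  - by move=> n; apply: measurableI => //; exact: measurable_funPTI.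
  - apply: bigcup_measurable => n _; apply: measurableI => //.
    exact: measurable_funPTI.
  - move=> n m nm; apply/subsetPset; apply: setSI; apply: preimage_subset.
    by apply: subset_itvl; rewrite bnd_simp nda.
apply: (lee_cvg_to (cvgP _ mB) (cvgP _ mB')).
by apply: nearW => n; exact: BB'.
Qed.

End Tails.

(** * Expectations of Z weighted by a function of X *)

Lemma measurable_superlevel (dS : measure_display) (S : measurableType dS)
    (R : realType) (f : S -> R) (c : R) :
  measurable_fun [set: S] f -> measurable [set w | c <= f w].
Proof.
move=> mf; rewrite -[X in measurable X]setTI.
have := mf measurableT `[c, +oo[%classic (measurable_itv _).
by congr (measurable (_ `&` _)); apply/seteqP; split => w /=;
  rewrite in_itv/= andbT.
Qed.

Section WeightedExpectation.
Context (d : measure_display) (T : measurableType d) (R : realType).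
Variable P : probability T R.
Implicit Types X Z : {RV P >-> R}.

Lemma Lfun1_le (f g : T -> R) : measurable_fun [set: T] f ->
  (forall w, `|f w| <= `|g w|) -> g \in Lfun P 1 -> f \in Lfun P 1.
Proof.
move=> mf fg /Lfun1_integrable ig; apply/Lfun1_integrable.
apply: (le_integrable measurableT _ _ ig); first exact/measurable_EFinP.
by move=> w _ /=; rewrite lee_fin.
Qed.

Lemma Lfun1_measurable (f : T -> R) : f \in Lfun P 1 -> measurable_fun [set: T] f.
Proof. by move=> /Lfun1_integrable /integrableP[/measurable_EFinP]. Qed.

Lemma Lfun1_norm (f : T -> R) : f \in Lfun P 1 ->
  (fun w => `|f w|) \in Lfun P 1.
Proof.
move=> fL; apply: (Lfun1_le _ _ fL) => [|w]; last by rewrite normr_id.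
by apply: measurableT_comp => //; exact: Lfun1_measurable fL.
Qed.

Lemma Lfun1_indic (f : T -> R) (A : set T) : measurable A ->
  f \in Lfun P 1 -> (f \* \1_A) \in Lfun P 1.
Proof.
move=> mA fL; apply: (Lfun1_le _ _ fL).
  by apply: measurable_funM; [exact: Lfun1_measurable|exact: measurable_indic].
move=> w /=; rewrite normrM indicE ler_piMr//.
by case: (w \in A) => /=; rewrite ?normr1// normr0.
Qed.

(** E(Z 1_A) is the difference of the integrals over z >= 0 of P(A, Z > z) and
    P(A, Z <= -z). The atoms of Z form a countable set, negligible for these
    integrals, so the tails need only be compared at the other points; this is
    why left skewness at continuity points is enough. *)
Lemma expectation_indic_le0 Z (A : set T) : measurable A ->
  (Z : T -> R) \in Lfun P 1 ->
  (forall z, 0 <= z -> pmf Z z = 0 ->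
    (P (A `&` Z @^-1` `]z, +oo[) <= P (A `&` Z @^-1` `]-oo, (- z)%R]))%E) ->
  ('E_P[Z \* \1_A] <= 0)%E.
Proof.
move=> mA ZL tail.
have [Y YE] : exists Y : {RV P >-> R}, (Y : T -> R) = Z \* \1_A.
  by exists (Z * mindic R mA)%R.
have Yw w : Y w = Z w * (w \in A)%:R by rewrite YE /= indicE.
have YL : (Y : T -> R) \in Lfun P 1 by rewrite YE; exact: Lfun1_indic.
rewrite -YE expectation_cdf_ccdf; last by rewrite inE in YL.
have ccdfE r : 0 <= r -> ccdf Y r = P (A `&` Z @^-1` `]r, +oo[).
  move=> r0; congr (P _); apply/seteqP; split => w /=; rewrite !in_itv/= !andbT Yw.
    case: (boolP (w \in A)) => [/set_mem Aw|_]; first by rewrite mulr1.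
    by rewrite mulr0 ltNge r0.
  by move=> [/mem_set -> ]; rewrite mulr1.
have cdfE r : (P (A `&` Z @^-1` `]-oo, (- r)%R]) <= cdf Y (- r)%R)%E.
  apply: le_measure; rewrite ?inE.
  - by apply: measurableI => //; exact: measurable_funPTI.
  - exact: measurable_funPTI.
  - by move=> w [/mem_set Aw]; rewrite /= !in_itv/= Yw Aw mulr1.
have mcdfN : measurable_fun [set: R] (fun r => cdf Y (- r)).
  apply: measurableT_comp; first exact: cdf_measurable.
  exact: measurable_funN.
have -> : (\int[lebesgue_measure]_(r in `]-oo, 0%R[) cdf Y r =
    \int[lebesgue_measure]_(r in `[0%R, +oo[) cdf Y (- r)%R)%E.
  rewrite (ge0_integration_by_substitution0 mcdfN)//.
  rewrite integral_itv_bndo_bndc.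
    by apply: eq_integral => r _; rewrite opprK.
  by apply: measurable_funTS; exact: cdf_measurable.
rewrite sube_le0.
apply: ae_ge0_le_integral => //.
- by apply: measurable_funTS; exact: ccdf_measurable.
- exact: measurable_funTS.
have cN := pmf_gt0_countable Z.
exists [set r | 0 < pmf Z r]; split.
- exact: countable_measurable.
- exact: countable_lebesgue_measure0.
- move=> r /= /not_implyP[]; rewrite in_itv/= andbT => r0 nle.
  rewrite lt_neqAle pmf_ge0 andbT eq_sym; apply/eqP => pr; apply: nle.
  by rewrite ccdfE//; apply: (le_trans (tail _ r0 pr)); exact: cdfE.
Qed.

(** Layer cake: h is approximated uniformly, within e, by a nonnegative
    combination of indicators of its superlevel sets, which changes E(Z h) by
    at most e E|Z|. *)
Lemma expectation_mul_le0 (Z h : T -> R) (M : R) : Z \in Lfun P 1 ->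
  measurable_fun [set: T] h -> (forall w, 0 <= h w <= M) ->
  (forall c : R, ('E_P[Z \* \1_[set w | (c <= h w)%R]] <= 0)%E) ->
  ('E_P[Z \* h] <= 0)%E.
Proof.
move=> ZL mh hM cut.
have mcut c : measurable [set w | c <= h w] by exact: measurable_superlevel.
have mZ := Lfun1_measurable ZL.
(* S e n rounds h down to a multiple of e, as soon as n.+1 * e exceeds the
   bound M on h. *)
pose S (e : R) (n : nat) w := \sum_(k < n) e * \1_[set w | k.+1%:R * e <= h w] w.
have SL e n : 0 < e -> (Z \* S e n) \in Lfun P 1 /\ ('E_P[Z \* S e n] <= 0)%E.
  move=> e0; elim: n => [|n [IHL IHE]].
    have -> : Z \* S e 0 = cst 0.
      by apply/funext => w /=; rewrite /S big_ord0 mulr0.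
    by rewrite expectation_cst Lfun_cst.
  have -> : Z \* S e n.+1 =
      (Z \* S e n) \+ (e \o* (Z \* \1_[set w | n.+1%:R * e <= h w])).
    by apply/funext => w /=; rewrite /S big_ord_recr/=; ring.
  have ZnL := Lfun1_indic (mcut (n.+1%:R * e)) ZL.
  split; first by rewrite rpredD// Lfun_scale.
  rewrite expectationD ?Lfun_scale// expectationZl//.
  by rewrite adde_le0// mule_ge0_le0// lee_fin ltW.
have ZhL : (Z \* h) \in Lfun P 1.
  apply: (@Lfun1_le _ (M \o* Z)); last by rewrite Lfun_scale.
    exact: measurable_funM.
  move=> w /=; rewrite !normrM ler_wpM2l//.
  by have /andP[h0 hle] := hM w; rewrite !ger0_norm// (le_trans h0).
have aL := Lfun1_norm ZL.
have main (e : R) : 0 < e -> ('E_P[Z \* h] <= e%:E * 'E_P[fun w => `|Z w|%R])%E.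
  move=> e0; pose n := Num.truncn (M / e).
  have Sh w : `|h w - S e n w| <= e.
    have /andP[h0 hle] := hM w.
    have he : 0 <= h w / e by rewrite divr_ge0// ltW.
    have -> : S e n w = e * (Num.truncn (h w / e))%:R.
      rewrite /S -mulr_sumr; congr (_ * _).
      have len : (Num.truncn (h w / e) <= n)%N.
        by apply: le_truncn; rewrite ler_pM2r ?invr_gt0.
      transitivity (\sum_(k < n) (k < Num.truncn (h w / e))%N%:R : R).
        apply: eq_bigr => k _; rewrite indicE truncn_gt_nat ler_pdivlMr//.
        congr ((nat_of_bool _)%:R).
        by apply/idP/idP => [/set_mem|?]; [|exact: mem_set].
      transitivity (\sum_(k < Num.truncn (h w / e)) (1 : R)); last first.
        by rewrite sumr_const card_ord.
      rewrite (big_ord_widen n (fun=> 1 : R) len) [RHS]big_mkcond/=.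
      by apply: eq_bigr => k _; case: ifP.
    have /andP := truncn_itv he.
    rewrite ler_pdivlMr// ltr_pdivrMr// -natr1 => -[] h1 h2.
    by rewrite ler_norml; apply/andP; split; lra.
  have [ZSL ZSE] := SL e n e0.
  have -> : Z \* h = (Z \* S e n) \+ (Z \* (h \- S e n)).
    by apply/funext => w /=; ring.
  have ZrL : (Z \* (h \- S e n)) \in Lfun P 1.
    have -> : Z \* (h \- S e n) = (Z \* h) \- (Z \* S e n).
      by apply/funext => w /=; ring.
    by rewrite rpredB.
  rewrite expectationD// -expectationZl//.
  rewrite -[leRHS]add0e; apply: leeD => //.
  rewrite unlock; apply: le_integral => //.
  - exact/Lfun1_integrable.
  - by apply/Lfun1_integrable; rewrite Lfun_scale.
  - move=> w _ /=; rewrite lee_fin (le_trans (ler_norm _))// normrM.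
    by rewrite ler_wpM2l.
have xfin := expectation_fin_num ZhL.
have yfin := expectation_fin_num aL.
move: main; rewrite -(fineK xfin) -(fineK yfin).
set x := fine _; set y := fine _ => main.
have y0 : 0 <= y by rewrite fine_ge0// expectation_ge0.
rewrite lee_fin leNgt; apply/negP => x0.
have y1 : 0 < y + 1 by lra.
have := main (x / (y + 1)) (divr_gt0 x0 y1).
rewrite -EFinM lee_fin mulrAC ler_pdivlMr//; lra.
Qed.

(** The superlevel sets of k are lower sets, so on each event c <= k(X) the
    lower tail of Z dominates. *)
Lemma expectation_mul_nonincreasing_le0 X Z (C : R -> R -> R) (k : R -> R) (M : R) :
  (Z : T -> R) \in Lfun P 1 -> left_skewed Z -> copula_of C X Z ->
  (forall u v : R, 0 <= u <= 1 -> 0 <= v <= 1 -> u <= C u v + C u (1 - v)) ->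
  nonincreasing_fun k -> (forall x, 0 <= k x <= M) ->
  ('E_P[Z \* (k \o X)] <= 0)%E.
Proof.
move=> ZL skew copC Cge ni kM.
have mk : measurable_fun [set: R] k by exact: nonincreasing_measurable.
have mkX : measurable_fun [set: T] (k \o X) by exact: measurableT_comp.
apply: (@expectation_mul_le0 Z (k \o X) M) => //; first by move=> w; exact: kM.
move=> c; pose D := [set x | c <= k x].
have -> : [set w | c <= (k \o X) w] = X @^-1` D by [].
have mD : measurable D by exact: measurable_superlevel.
apply: expectation_indic_le0 => //; first exact: measurable_funPTI.
move=> z z0 atom0; apply: lower_set_tail_le; [exact: measurable_funPTI..| |].
- by move=> x y /= cx yx; apply: (le_trans cx); exact: ni.
- by move=> x; exact: copula_tail_le Cge z0 atom0.
Qed.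

End WeightedExpectation.

(** * Expectations that may be infinite *)

Section InfiniteExpectation.
Context (d : measure_display) (T : measurableType d) (R : realType).
Variable P : probability T R.

(** With g integrable, the comparison is valid even if E f is -oo, which cannot
    be excluded for the utility of an integrable variable. *)
Lemma le_expectation_Lfun1 (f g : T -> R) : measurable_fun [set: T] f ->
  g \in Lfun P 1 -> (forall w, f w <= g w) -> ('E_P[f] <= 'E_P[g])%E.
Proof.
move=> mf gL fg; have mg := Lfun1_measurable gL.
have [mf' mg'] : measurable_fun [set: T] (EFin \o f) /\
    measurable_fun [set: T] (EFin \o g) by split; exact/measurable_EFinP.
rewrite unlock integralE [leRHS]integralE leeB//.
- apply: ge0_le_integral => //; [exact: measurable_funepos..|].
  by move=> w /mem_set; apply: funepos_le => ? _; rewrite lee_fin.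
- apply: ge0_le_integral => //; [exact: measurable_funeneg..|].
  by move=> w /mem_set; apply: funeneg_le => ? _; rewrite lee_fin.
Qed.

(** Monotone convergence for the nonnegative increasing sequence f_0 - f_n; a
    finite lower bound c forces f to be integrable. *)
Lemma expectation_nonincreasing_limit_ge (f_ : nat -> T -> R) (f : T -> R)
    (c : \bar R) :
  measurable_fun [set: T] f ->
  (forall n, f_ n \in Lfun P 1) ->
  (forall w, nonincreasing_seq (f_ ^~ w)) ->
  (forall w, f_ n w @[n --> \oo] --> f w) ->
  (forall n, (c <= 'E_P[f_ n])%E) -> (c <= 'E_P[f])%E.
Proof.
move=> mf fL ni fcvg cf.
have mf_ n := Lfun1_measurable (fL n).
have ff0 w : f w <= f_ 0%N w.
  have := fcvg w; move=> /[dup] /cvgP fw /(cvg_lim (@Rhausdorff R)) <-.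
  exact: (nonincreasing_cvgn_ge (ni w) fw).
case: c cf => [c|/(_ 0%N)|_]; last by rewrite leNye.
- move=> cf.
  have gE n : ('E_P[f_ 0%N \- f_ n] <= 'E_P[f_ 0%N] - c%:E)%E.
    by rewrite expectationB// leeB.
  have gcvg : ('E_P[f_ 0%N \- f_ n] @[n --> \oo] --> 'E_P[f_ 0%N \- f])%E.
    rewrite unlock.
    have := @cvg_monotone_convergence _ _ _ P _ measurableT
      (fun n w => (f_ 0%N w - f_ n w)%:E).
    have -> : (\int[P]_w ((f_ 0%N \- f) w)%:E =
        \int[P]_w limn (fun n => (f_ 0%N w - f_ n w)%:E))%E.
      apply: eq_integral => w _; apply/esym/cvg_lim => //.
      by apply: cvg_EFin; [exact: nearW|apply: cvgB => //; exact: cvg_cst].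
    apply.
    + by move=> n; apply/measurable_EFinP; exact: measurable_funB.
    + by move=> n w _; rewrite lee_fin subr_ge0 ni.
    + by move=> w _ n m nm; rewrite lee_fin lerD2l lerN2 ni.
  have gle : ('E_P[f_ 0%N \- f] <= 'E_P[f_ 0%N] - c%:E)%E.
    by apply: (cvge_to_le gcvg); exact: nearW.
  have gL : (f_ 0%N \- f) \in Lfun P 1.
    apply/Lfun1_integrable/integrableP; split.
      by apply/measurable_EFinP; exact: measurable_funB.
    under eq_integral => w _ do rewrite /= ger0_norm ?subr_ge0//.
    have glty : ('E_P[f_ 0%N] - c%:E < +oo)%E.
      by rewrite ltey_eq fin_numB expectation_fin_num.
    by move: (le_lt_trans gle glty); rewrite [in X in X -> _]unlock.
  have fLf : f \in Lfun P 1.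
    have -> : f = f_ 0%N \- (f_ 0%N \- f) by apply/funext => w /=; ring.
    exact: rpredB.
  move: gle; rewrite expectationB//.
  rewrite -(fineK (expectation_fin_num (fL 0%N))).
  rewrite -(fineK (expectation_fin_num fLf)).
  by rewrite -!EFinB !lee_fin; lra.
- by rewrite leye_eq => /eqP E0; have := expectation_fin_num (fL 0%N); rewrite E0.
Qed.

End InfiniteExpectation.

(** * The increasing concave order *)

Theorem proposition3p9 (d : measure_display) (T : measurableType d)
    (R : realType) (P : probability T R) (hP : atomless P)
    (X Z : {RV P >-> R})
    (hX : (X : T -> R) \in Lfun P 1) (hZ : (Z : T -> R) \in Lfun P 1)
    (hskew : left_skewed Z)
    (C : R -> R -> R) (hC : copula_of C X Z)
    (hCge : forall u v : R, 0 <= u <= 1 -> 0 <= v <= 1 ->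
      u <= C u v + C u (1 - v)) :
  leICV P (X \+ Z) X.
Proof.
move=> u und uconc _ _.
have mu : measurable_fun [set: R] u by exact: nondecreasing_measurable.
pose g := left_slope u; pose m n : R := - n%:R.
pose u_ n := tangent_extension u (m n).
pose k n x := g (Num.max x (m n)).
have kni n : nonincreasing_fun (k n).
  move=> x y xy; apply: left_slope_nonincreasing => //.
  by rewrite ge_max !le_max xy lexx orbT.
have kM n x : 0 <= k n x <= g (m n).
  rewrite left_slope_ge0//=; apply: left_slope_nonincreasing => //.
  by rewrite le_max lexx orbT.
have mk n : measurable_fun [set: R] (k n) by exact: nonincreasing_measurable.
have mmax n : measurable_fun [set: R] (fun x => Num.max x (m n)).
  exact: measurable_maxr.
have mu_ n : measurable_fun [set: R] (u_ n).
  apply: measurable_funD; first exact: measurableT_comp.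
  apply: measurable_funM; first exact: mk.
  exact: measurable_funB.
have mX : measurable_fun [set: T] X := Lfun1_measurable hX.
have cstL (c : R) : cst c \in Lfun P 1 by exact: Lfun_cst.
have u_L n : (u_ n \o X) \in Lfun P 1.
  have XL a : (fun w => X w - a) \in Lfun P 1 by apply: rpredB => //; exact: cstL.
  (* u_ n \o X lies between an affine function of |X - m n| and one of X. *)
  pose B w := `|u 0 + X w * g 0| + (`|u (m n)| + `|X w - m n| * g (m n)).
  have BL : B \in Lfun P 1.
    apply: rpredD.
      by apply: Lfun1_norm; apply: rpredD; [exact: cstL|rewrite Lfun_scale].
    apply: rpredD; first exact: cstL.
    by rewrite (@Lfun_scale _ _ _ _ (fun w => `|X w - m n|)) ?Lfun1_norm.
  apply: (Lfun1_le _ _ BL); first exact: measurableT_comp.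
  move=> w /=; have := @tangent_extension_le _ u und uconc (m n) (X w).
  rewrite oppr_le0 ler0n => /(_ isT).
  have := @tangent_extension_ge _ u und (m n) (X w).
  rewrite -/(u_ n) -/g ![g _ * _]mulrC => lo hi.
  rewrite (le_trans _ (ler_norm _))// /B.
  have := ler_norm (u 0 + X w * g 0); have := normr_ge0 (u 0 + X w * g 0).
  have : - u (m n) <= `|u (m n)| by rewrite -normrN ler_norm.
  have := normr_ge0 (u (m n)).
  have : 0 <= `|X w - m n| * g (m n) by rewrite mulr_ge0// left_slope_ge0.
  by rewrite ler_norml => *; apply/andP; split; lra.
have kL n : (Z \* (k n \o X)) \in Lfun P 1.
  apply: (@Lfun1_le _ _ _ P _ (g (m n) \o* Z)); last by rewrite Lfun_scale.
    apply: measurable_funM; first exact: Lfun1_measurable hZ.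
    exact: measurableT_comp.
  move=> w /=; rewrite !normrM ler_wpM2l//.
  have /andP[k0 kle] := kM n (X w).
  by rewrite !ger0_norm// (le_trans k0).
apply: (@expectation_nonincreasing_limit_ge _ _ _ P (fun n => u_ n \o X)).
- exact: measurableT_comp.
- exact: u_L.
- move=> w n p np; apply: tangent_extension_homo => //.
  by rewrite lerN2 ler_nat.
(* u_ n (X w) = u (X w) as soon as n >= |X w|. *)
- move=> w; apply: cvg_near_cst.
  exists (Num.truncn `|X w|).+1 => // n /= nX.
  rewrite /u_ tangent_extension_id// /m lerNl.
  rewrite (le_trans (ler_norm _))// normrN (le_trans (ltW (truncnS_gt _)))//.
  by rewrite ler_nat.
- move=> n.
  have le : ('E_P[u \o (X \+ Z)%R] <= 'E_P[((u_ n \o X) \+ (Z \* (k n \o X)))%R])%E.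
    apply: le_expectation_Lfun1.
    + apply: measurableT_comp => //; apply: measurable_funD => //.
    + by rewrite rpredD.
    + move=> w /=.
      have := concave_le_tangent_extension und uconc (m n) (X w) (X w + Z w).
      by rewrite -/(u_ n) -/g -/(k n _) [X w + _ - _]addrC addKr [Z w * _]mulrC.
  apply: (le_trans le); rewrite expectationD// -[leRHS]adde0; apply: leeD => //.
  exact: expectation_mul_nonincreasing_le0 hCge (kni n) (kM n).
Qed.
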